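(* Let $G$ be a $\Delta$-regular graph of order $n$ with $\Delta\ge 3$. Then $$L_2(G)\ \ge\ \frac{2n}{\Delta^2-\Delta+2}.$$
   Context: All graphs are finite, simple and undirected. For a vertex $v$, $N[v]$ denotes the closed neighbourhood of $v$. A vertex set $X\subseteq V(G)$ is a $k$-limited packing if $|N[v]\cap X|\le k$ for every $v\in V(G)$; $L_k(G)$ is the maximum size of a $k$-limited packing in $G$. *)

(* Defs.v *)
From mathcomp Require Import all_boot all_order all_algebra.

Set Implicit Arguments.
Unset Strict Implicit.
Unset Printing Implicit Defensive.

Record sgraph := SGraph {
  vertex :> finType;
  adj : rel vertex;
  adj_sym : symmetric adj;
  adj_irrefl : irreflexive adj
}.

Definition neigh (G : sgraph) (v : G) : {set G} := [set u | adj v u].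

Definition closed_neigh (G : sgraph) (v : G) : {set G} := v |: neigh v.

Definition regular (G : sgraph) (d : nat) : Prop :=
  forall v : G, #|neigh v| = d.

Definition limited_packing (G : sgraph) (k : nat) (X : {set G}) : bool :=
  [forall v : G, #|closed_neigh v :&: X| <= k].

(* The empty set is always a k-limited packing, so the default value 0 of
   \max does not affect the result. *)
Definition limited_packing_number (G : sgraph) (k : nat) : nat :=
  \max_(X : {set G} | limited_packing k X) #|X|.

(* Main.v *)
(* Let X be a 2-limited packing of maximum size, and count the paths (x, u, v)
   with x in X, x ~ u ~ v and v != x; there are |X| Delta (Delta - 1) of them.
   Call u full if it has two neighbours in X.  Assign (x, u, v) to v if u is
   full and v is outside X, and to u otherwise.  Then every v outside X receives
   at least two paths:
   - if v is full, with neighbours x and y in X, the paths (x, v, y), (y, v, x);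
   - if v has a neighbour x in X but is not full, the Delta - 1 >= 2 paths
     (x, v, _);
   - if v has no neighbour in X, maximality of X gives a full neighbour u of v,
     and v receives the paths (x, u, v) for the neighbours x of u in X.
   Hence 2 (n - |X|) <= |X| Delta (Delta - 1). *)
Require Import Defs.
From mathcomp Require Import all_boot all_order all_algebra.
From mathcomp Require Import zify ring.

Import GRing.Theory Num.Theory.
Local Open Scope ring_scope.

Section TwoPaths.
Local Open Scope nat_scope.
Variables (G : sgraph) (X : {set G}).

Definition full (u : G) : bool := 1 < #|neigh u :&: X|.

Definition two_path (t : G * G * G) : bool :=
  [&& t.1.1 \in X, adj t.1.1 t.1.2, adj t.1.2 t.2 & t.2 != t.1.1].

Definition receiver (t : G * G * G) : G :=
  if full t.1.2 && (t.2 \notin X) then t.2 else t.1.2.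

Lemma card_two_path (d : nat) : regular G d ->
  #|two_path| = #|X| * (d * d.-1).
Proof.
move=> regG.
have -> : #|two_path| =
    \sum_(x in X) \sum_(u | adj x u) \sum_(v | adj u v && (v != x)) 1.
  rewrite pair_big_dep pair_big_dep -sum1_card; apply: eq_bigl => -[[x u] v].
  by rewrite /in_mem /= /two_path /= !andbA.
rewrite -sum_nat_const; apply: eq_bigr => x _.
rewrite -{1}(regG x) -sum_nat_const.
apply: eq_big => [u|u xu]; first by rewrite inE.
(* [x] is itself one of the [d] neighbours of [u], which leaves [d.-1] choices for [v]. *)
rewrite sum1_card -(regG u) (cardsD1 x (neigh u)) inE adj_sym xu add1n /=.
by apply: eq_card => v; rewrite !inE andbC.
Qed.

(** Adding [v] affects the count in a closed neighbourhood only if [v] lies in it, and then by at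
    most one. So a vertex where the enlarged set has more than 2 elements already sees two elements
    of [X]. *)
Lemma maximal_blocked (v : G) :
  limited_packing 2 X -> ~~ limited_packing 2 (v |: X) ->
  exists2 u, v \in closed_neigh u & 1 < #|closed_neigh u :&: X|.
Proof.
move=> /forallP packX /forallPn [u]; rewrite -ltnNge => gt2.
have [vu|vNu] := boolP (v \in closed_neigh u).
  exists u => //.
  have sub : closed_neigh u :&: (v |: X) \subset v |: (closed_neigh u :&: X).
    by rewrite setUIr setSI // subsetUr.
  have := leq_trans gt2 (subset_leq_card sub).
  by rewrite cardsU1; case: (v \notin _); lia.
suff E : closed_neigh u :&: (v |: X) = closed_neigh u :&: X.
  by move: gt2; rewrite E ltnNge packX.
apply/setP => w; rewrite !in_setI in_setU1.
by have [->|] := eqVneq w v; rewrite ?(negbTE vNu).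
Qed.

Lemma receives_two (d : nat) (v : G) : regular G d -> 3 <= d ->
  limited_packing 2 X -> v \notin X -> ~~ limited_packing 2 (v |: X) ->
  1 < #|[pred t | two_path t & receiver t == v]|.
Proof.
move=> regG d3 packX vX maxX; apply/card_gt1P.
have [fv|nfv] := boolP (full v).
  have /card_gt1P [x [y [xv yv nxy]]] := fv.
  move: xv yv; rewrite !inE => /andP[vx xX] /andP[vy yX].
  exists (x, v, y), (y, v, x); rewrite !inE /two_path /receiver /= xX yX vx vy.
  by rewrite !andbF (adj_sym x) (adj_sym y) vx vy eqxx eq_sym nxy !xpair_eqE
    (negbTE nxy).
have [|[x]] := set_0Vmem (neigh v :&: X); last first.
  rewrite !inE => /andP[vx xX].
  have /card_gt1P [w [z [wv zv nwz]]] : 1 < #|neigh v :\ x|.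
    by move: (cardsD1 x (neigh v)); rewrite regG inE vx; lia.
  move: wv zv; rewrite !inE => /andP[nwx vw] /andP[nzx vz].
  exists (x, v, w), (x, v, z).
  rewrite !inE /two_path /receiver /= xX (adj_sym x) vx vw vz nwx nzx.
  by rewrite (negbTE nfv) eqxx xpair_eqE (negbTE nwz) andbF.
move=> noX.
have NX w : adj v w -> w \notin X.
  move=> vw; apply/negP => wX.
  by have := in_set0 w; rewrite -noX !inE vw wX.
have [u] := maximal_blocked v packX maxX.
rewrite !inE => /orP[/eqP <-|uv].
  (* The case [u = v] is impossible: no neighbour of [v] is in [X], so an element of [X] in the
     closed neighbourhood would be [v] itself. *)
  move=> /card_gt1P [x [y [+ +]]]; rewrite !inE.
  move=> /andP[/orP[/eqP->|/NX/negbTE->] // vX' _].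
  by rewrite vX' in vX.
(* Since [u] is outside [X], its closed and open neighbourhoods meet [X] in the same set, so [u] is
   full. *)
have uX : u \notin X by apply: NX; rewrite adj_sym.
have -> : closed_neigh u :&: X = neigh u :&: X.
  by apply/setP => w; rewrite !inE; case: eqVneq => // ->;
    rewrite (negbTE uX) !andbF.
move=> fu; have /card_gt1P [x [y [xu yu nxy]]] := fu.
move: xu yu; rewrite !inE => /andP[ux xX] /andP[uy yX].
exists (x, u, v), (y, u, v).
rewrite !inE /two_path /receiver /= xX yX (adj_sym x) (adj_sym y) ux uy uv.
rewrite [full u]fu vX eqxx !xpair_eqE (negbTE nxy) !andbT.
by split=> //; apply: contraNneq vX => ->.
Qed.

Lemma maximal_packing_bound (d : nat) : regular G d -> 3 <= d ->
  limited_packing 2 X ->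
  (forall v, v \notin X -> ~~ limited_packing 2 (v |: X)) ->
  2 * #|G| <= #|X| * (d * d.-1 + 2).
Proof.
move=> regG d3 packX maxX.
suff : #|~: X| * 2 <= #|X| * (d * d.-1) by move: (cardsC X); lia.
rewrite -(card_two_path d regG) -sum_nat_const -sum1_card.
rewrite (partition_big receiver xpredT) //=.
(* Paths received inside [X] are discarded. *)
rewrite [leqRHS](bigID (fun v => v \in ~: X)) /=.
apply: leq_trans (leq_addr _ _); apply: leq_sum => v; rewrite inE => vX.
by rewrite sum1_card; exact: (receives_two d v regG d3 packX vX (maxX v vX)).
Qed.

End TwoPaths.

Lemma limited_packing_number_attained (G : sgraph) (k : nat) :
  exists2 X : {set G}, limited_packing k X & #|X| = limited_packing_number G k.
Proof.
(* The maximum is over a nonempty family, hence attained. *)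
have pack0 : limited_packing k (set0 : {set G}).
  by apply/forallP => v; rewrite setI0 cards0.
have [|X packX eqX] := @eq_bigmax_cond _ [pred X : {set G} | limited_packing k X]
    (fun X => #|X|).
  by apply/card_gt0P; exists set0.
by exists X.
Qed.

Theorem theorem4 (G : sgraph) (n Delta : nat)
    (order_G : #|G| = n) (regular_G : regular G Delta)
    (Delta_ge3 : (3 <= Delta)%N) :
  (limited_packing_number G 2)%:R >=
    2 * n%:R / (Delta%:R ^+ 2 - Delta%:R + 2) :> rat.
Proof.
have [X packX sizeX] := limited_packing_number_attained G 2.
have maxX v : v \notin X -> ~~ limited_packing 2 (v |: X).
  move=> vX; apply/negP => packvX.
  have : (#|v |: X| <= limited_packing_number G 2)%N by exact: leq_bigmax_cond.
  by rewrite -sizeX cardsU1 vX; lia.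
have := maximal_packing_bound G X Delta regular_G Delta_ge3 packX maxX.
rewrite order_G sizeX.
(* As [Delta] is positive, the truncated [Delta.-1] is the true difference. *)
have -> : Delta%:R ^+ 2 - Delta%:R + 2 = (Delta * Delta.-1 + 2)%:R :> rat.
  by case: Delta Delta_ge3 {regular_G} => // d _ /=; rewrite natrD natrM -natr1; ring.
move=> bound; rewrite ler_pdivrMr; first by rewrite -!natrM ler_nat.
by rewrite ltr0n addn2.
Qed.
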